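(* The integration problem of computing $\mathrm{INT}(f)=\int_0^1f(x)\,dx$ (with respect to the Lebesgue measure on $[0,1]$) by general randomized algorithms is not solvable on the class $\mathcal F=C^\infty([0,1])$ of infinitely differentiable functions.
   Context: Let $G=[0,1]$. A general randomized algorithm $Q$ on a class $\mathcal F$ of measurable functions $G\to\mathbb R$ lives on a probability space $(\Omega,\Sigma,\mathbb P)$ and consists of: a random variable $U$ with values in a measurable space $(\mathbb U,\Sigma_U)$; a measurable output function $\phi:\mathbb U\times\mathbb R^{\mathbb N}\to\mathbb R$; a measurable stopping rule $n:\mathbb U\times\mathbb R^{\mathbb N}\to\mathbb N_0\cup\{\infty\}$ such that whether $n(u,(y_j)_j)\ge i$ depends only on $(u,y_1,\dots,y_{i-1})$; and measurable sampling nodes $\mathbf X_i:\Omega\times\mathbb R^{i-1}\to G$, $i\in\mathbb N$. For $f\in\mathcal F$ the information $N(\omega,f)=(y_i)_{i\in\mathbb N}$ is given (recursively) by $y_i=f(\mathbf X_i(\omega,y_1,\dots,y_{i-1}))$ if $n(U(\omega),(y_j)_j)\ge i$ and $y_i=0$ otherwise; the information map is assumed measurable. The output is $Q(\omega,f):=\phi(U(\omega),N(\omega,f))$, $Q(f):=Q(\cdot,f)$, and the cost $n(\omega,f):=n(U(\omega),N(\omega,f))$ is assumed almost surely finite for every $f\in\mathcal F$. The integration problem is solvable on $\mathcal F$ if for all $\varepsilon>0$ and $\delta\in(0,1)$ there is a general randomized algorithm $Q$ on $\mathcal F$ such that $\mathbb P\{|Q(f)-\mathrm{INT}(f)|\le\varepsilon\}\ge1-\delta$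 for all $f\in\mathcal F$. *)

(* Defs.v *)
From HB Require Import structures.
From mathcomp Require Import all_boot all_order all_algebra.
From mathcomp Require Import all_classical all_reals all_analysis.

Set Implicit Arguments.
Unset Strict Implicit.
Unset Printing Implicit Defensive.

Import Order.TTheory GRing.Theory Num.Theory.
Import numFieldNormedType.Exports.

Local Open Scope classical_set_scope.
Local Open Scope ring_scope.

(* The elements of a class are functions [R -> R] of which only the values on
   [0, 1] matter: the sampling nodes lie in [0, 1] and so does the domain of
   integration. The indices of samples start at 0: the [i]-th sample here is
   the (i+1)-st in the usual counting. *)

Definition cylinders (R : realType) : set_system (nat -> R) :=
  \bigcup_i preimage_set_system setT (fun y : nat -> R => y i) measurable.

(* R^N with the product sigma-algebra *)
Notation seqR R := (g_sigma_algebraType (@cylinders R)).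

(* N ∪ {∞}, with [None] for ∞ *)
Definition at_least (n : option nat) (i : nat) : bool :=
  if n is Some k then (i <= k)%N else true.

Section information.
Variables (R : realType) (n : (nat -> R) -> option nat).
Variables (X : forall i, i.-tuple R -> R) (f : R -> R).

(* [n] is evaluated at the known prefix padded with 0, which is harmless for a
   nonanticipating stopping rule; [infoE] below is the usual recursion *)
Fixpoint info_prefix (i : nat) : i.-tuple R :=
  match i with
  | 0 => [tuple]
  | j.+1 =>
    let y := info_prefix j in
    [tuple of rcons y
      (if at_least (n (nth 0 y)) j.+1 then f (X y) else 0)]
  end.

Definition info (i : nat) : R := last 0 (info_prefix i.+1).

Definition nonanticipating := forall (i : nat) (y z : nat -> R),
  (forall j, (j < i)%N -> y j = z j) ->
  at_least (n y) i.+1 = at_least (n z) i.+1.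

Lemma nth_info_prefix (i j : nat) : (j < i)%N ->
  nth 0 (info_prefix i) j = info j.
Proof.
elim: i => // i IHi; rewrite ltnS leq_eqVlt => /predU1P[->|ji].
  by rewrite /info (last_nth 0) size_tuple.
by rewrite /= nth_rcons size_tuple ji IHi.
Qed.

Lemma infoE : nonanticipating -> forall i,
  info i = if at_least (n info) i.+1 then f (X [tuple info j | j < i]) else 0.
Proof.
move=> nP i; rewrite /info /= last_rcons.
rewrite (nP i _ info) => [|j ji]; last exact: nth_info_prefix.
congr (if _ then f (X _) else _); apply: eq_from_tnth => j.
by rewrite tnth_mktuple (tnth_nth 0) nth_info_prefix.
Qed.

End information.

Record rand_algorithm (R : realType) (F : set (R -> R)) := RandAlgorithm {
  Omega_display : measure_display ;
  Omega : measurableType Omega_display ;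
  prob : probability Omega R ;
  U_display : measure_display ;
  U_space : measurableType U_display ;
  U : {RV prob >-> U_space} ;
  phi : U_space * seqR R -> R ;
  stop : U_space * seqR R -> option nat ;
  node : forall i : nat, Omega * i.-tuple R -> R ;
  algo_info : Omega -> (R -> R) -> seqR R := fun w f =>
    info (fun y => stop (U w, y)) (fun i y => node (w, y)) f ;
  measurable_phi : measurable_fun setT phi ;
  measurable_stop : forall B : set (option nat), measurable (stop @^-1` B) ;
  stop_nonanticipating : forall u, nonanticipating (fun y => stop (u, y)) ;
  measurable_node : forall i, measurable_fun setT (@node i) ;
  node01 : forall i wy, @node i wy \in `[0, 1] ;
  measurable_info : forall f, F f -> measurable_fun setT (algo_info ^~ f) ;
  cost_finite : forall f, F f ->
    {ae prob, forall w, stop (U w, algo_info w f) != None}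
}.

Definition output (R : realType) (F : set (R -> R)) (Q : rand_algorithm F)
    (w : Omega Q) (f : R -> R) : R :=
  phi (U Q w, algo_info w f).

Definition INT (R : realType) (f : R -> R) : R :=
  \int[@lebesgue_measure R]_(x in `[0, 1]) f x.

Definition integration_solvable (R : realType) (F : set (R -> R)) : Prop :=
  forall eps delta : R, 0 < eps -> 0 < delta < 1 ->
  exists Q : rand_algorithm F, forall f, F f ->
    ((1 - delta)%:E <=
       prob Q [set w | (`|output w f - INT f| <= eps)%R])%E.

(* [D k] is the k-th derivative of [f] on [0, 1], one-sided at 0 and 1 *)
Definition Cinfty01 (R : realType) : set (R -> R) :=
  [set f | exists2 D : nat -> R -> R, D 0%N = f &
    forall (k : nat) (x : R), x \in `[0, 1] ->
      (D k y - D k x) / (y - x) @[y --> within `[0, 1] x^'] --> D k.+1 x].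

Lemma Cinfty01_continuous (R : realType) (f : R -> R) :
  Cinfty01 f -> {within `[0, 1], continuous f}.
Proof.
move=> [D <- DP]; apply/subspace_continuousP => x x01.
have cid : y - x @[y --> within `[0, 1] x^'] --> (0 : R).
  apply/cvgrPdist_lt => e e0; rewrite !near_withinE.
  near=> y => _ _; rewrite sub0r normrN distrC.
  by near: y; exact: nbhsx_ballx.
have := cvgM (DP 0%N x x01) cid; rewrite mulr0.
move=> /(_ (within_filter _ _))/cvgrPdist_lt c0.
apply/cvgrPdist_lt => e e0; have := c0 e e0.
rewrite !near_withinE => H.
near=> y => y01.
have [->|yx] := eqVneq y x; first by rewrite subrr normr0.
have : y != x -> `[0, 1]%classic y ->
    `|0 - (D 0%N y - D 0%N x) / (y - x) * (y - x)| < e.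
  by near: y; exact: H.
move=> /(_ yx y01); rewrite sub0r normrN divfK ?subr_eq0// distrC.
Unshelve. all: by end_near. Qed.

Lemma Cinfty01_integrable (R : realType) (f : R -> R) : Cinfty01 f ->
  (@lebesgue_measure R).-integrable `[0, 1] (EFin \o f).
Proof.
move=> /Cinfty01_continuous; apply: continuous_compact_integrable.
exact: segment_compact.
Qed.

(* Main.v *)
(** If the cost is almost surely finite on the zero function, then with
    probability close to 1 the nodes that the algorithm visits on the zero
    function all avoid the interval ]0, a[ for some small a > 0: this event
    increases to a full event as a decreases to 0. On this event the algorithm
    cannot distinguish the zero function from a smooth bump supported in ]0, a[
    of integral at least 3, so it cannot be within 1 of both integrals. *)
Require Import Defs.
From mathcomp Require Import all_boot all_order all_algebra.
From mathcomp Require Import all_classical all_reals all_analysis.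
From mathcomp Require Import ring lra.

Set Implicit Arguments.
Unset Strict Implicit.
Unset Printing Implicit Defensive.

Import Order.TTheory GRing.Theory Num.Theory.
Import numFieldNormedType.Exports.

Local Open Scope classical_set_scope.
Local Open Scope ring_scope.

(** * Smoothness of exp(-1/q) for a polynomial q *)

(** The substitution [h = y - x] turns the derivative into the quotients that [Cinfty01] asks for;
    restricting [y] to [A] preserves the limit. *)
Lemma quotient_cvg (R : realType) (f : R -> R) (x l : R) (A : set R) :
  is_derive x (1 : R) f l ->
  (f y - f x) / (y - x) @[y --> within A x^'] --> l.
Proof.
move=> [df dfE]; rewrite -dfE.
have -> : (fun y => (f y - f x) / (y - x)) =
    (fun h => h^-1 *: ((f \o shift x) (h *: 1) - f x)) \o (fun y => y - x).
  by apply/funext => y /=; rewrite /= [_ *: 1]mulr1 subrK [RHS]mulrC.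
apply: cvg_comp; last exact: df.
move=> B [e /= e0 eB]; exists e => //= y xy yx _; apply: eB; last by rewrite subr_eq0.
by rewrite /= sub0r normrN distrC.
Qed.

(** The exponential series bounds exp(1/t) from below by its term of degree m+1; take inverses. *)
Lemma expRN_inv_le (R : realType) (t : R) (m : nat) : 0 < t ->
  expR (- t^-1) <= (m.+1)`!%:R * t ^+ m.+1.
Proof.
move=> t0; rewrite expRN -[leRHS]invrK.
rewrite lef_pV2 ?posrE ?expR_gt0 ?invr_gt0 ?mulr_gt0 ?exprn_gt0 ?ltr0n ?fact_gt0//.
apply: le_trans (expR_ge1Dxn m _); last by rewrite invr_ge0 ltW.
by rewrite invfM mulrC exprVn lerDr.
Qed.

(* The function exp(-1/q) on {q > 0}, extended by 0, and its derivatives, which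
   on {q > 0} have the form b_n q^(-2n) exp(-1/q) with b_n a polynomial. *)
Section exp_inv_poly.
Variables (R : realType) (q : {poly R}).

(** The recursion differentiates b q^(-2m) exp(-1/q), then divides out exp(-1/q) and multiplies by
    q^(2m+2). *)
Fixpoint exp_inv_coef (n : nat) : {poly R} :=
  if n is m.+1 then
    let b := exp_inv_coef m in
    b^`() * q ^+ 2 - (b * q^`() * q) *+ m.*2 + b * q^`()
  else 1.

Definition exp_inv (n : nat) (x : R) : R :=
  if 0 < q.[x] then (exp_inv_coef n).[x] / q.[x] ^+ n.*2 * expR (- q.[x]^-1)
  else 0.

Lemma exp_inv_le n x :
  `|exp_inv n x| <= (n.*2.+2)`!%:R * `|(exp_inv_coef n).[x]| * q.[x] ^+ 2.
Proof.
rewrite /exp_inv; case: ifPn => [q0|_]; last first.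
  by rewrite normr0 mulr_ge0 ?sqr_ge0// mulr_ge0.
have qn0 : 0 < q.[x] ^+ n.*2 by rewrite exprn_gt0.
rewrite !normrM (ger0_norm (expR_ge0 _)) normfV (gtr0_norm qn0).
apply: le_trans (ler_wpM2l _ (expRN_inv_le n.*2.+1 q0)) _.
  by rewrite mulr_ge0// invr_ge0 ltW.
rewrite -addn2 exprD le_eqVlt; apply/orP; left; apply/eqP; field.
exact: lt0r_neq0.
Qed.

(** Three cases by the sign of q at [x]: the formula is differentiated where q is positive, the
    function is locally 0 where q is negative, and a squeeze settles the zeros of q. *)
Lemma exp_inv_quotient_cvg n x (A : set R) :
  (exp_inv n y - exp_inv n x) / (y - x) @[y --> within A x^'] -->
  exp_inv n.+1 x.
Proof.
have cq : {for x, continuous (horner q)} by exact: continuous_horner.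
have [q0|q0|q0] := ltgtP 0 q.[x].
- apply: quotient_cvg.
  pose b := exp_inv_coef n; pose s := q ^+ n.*2.
  apply: (@near_eq_is_derive _ _ _
    (fun y => b.[y] / s.[y] * expR (- q.[y]^-1))).
    have : \near x, 0 < q.[x] by exact: (cvgr_gt _ cq).
    by apply: filterS => y; rewrite /exp_inv => ->; rewrite horner_exp.
  have qn0 : q.[x] != 0 by exact: lt0r_neq0.
  have sn0 : s.[x] != 0 by rewrite horner_exp expf_neq0.
  have dV := is_deriveV qn0 (is_derive_poly q x).
  have dE := is_derive1_comp (is_derive_expR _) (is_deriveN dV).
  have dS := is_deriveV sn0 (is_derive_poly s x).
  have := is_deriveM (is_deriveM (is_derive_poly b x) dS) dE.
  move=> dd; apply: is_derive_eq.
  rewrite /exp_inv q0 /= -/b; rewrite /s in sn0 *; clear dS dd.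
  rewrite !fctE /= deriv_exp !hornerE doubleS !hornerMn !hornerE /= /GRing.scale /=.
  clear dV dE sn0 s.
  move: (expR _) => e.
  move: (b.[x]) (b^`().[x]) (q^`().[x]) (q.[x]) qn0 => b0 b1 q1 t t0.
  (* The derivative of q^k contains q^(k-1) with truncated subtraction, so k = 0 is treated
     apart. *)
  case: (n.*2) => [|m]; first by rewrite !mulr0n !expr0; field.
  rewrite /= -[q1 * _ *+ _]mulr_natr -[b0 * q1 * t *+ _]mulr_natr !exprS.
  have : t ^+ m != 0 by rewrite expf_neq0.
  by move: (t ^+ m) (m.+1%:R) => u k u0; field; rewrite t0 u0.
- have -> : exp_inv n.+1 x = 0 by rewrite /exp_inv ltNge (ltW q0).
  apply: quotient_cvg.
  apply: (@near_eq_is_derive _ _ _ (cst 0)).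
    have : \near x, q.[x] < 0 by exact: (cvgr_lt _ cq).
    by apply: filterS => y q0y; rewrite /exp_inv ltNge (ltW q0y).
have b0 m : exp_inv m x = 0 by rewrite /exp_inv -q0 ltxx.
rewrite !b0.
have [r qE] : exists r, q = r * ('X - x%:P).
  by apply/factor_theorem/rootP.
(* One factor of q^2 in [exp_inv_le] is split as r (y - x). The other stays in [g], which therefore
   still vanishes at [x]. *)
pose g := exp_inv_coef n * q * r.
pose K : R := (n.*2.+2)`!%:R.
have g0 : g.[x] = 0 by rewrite /g !hornerM -q0 mulr0 mul0r.
have cg : K * `|g.[y]| @[y --> within A x^'] --> (0 : R).
  rewrite -[X in _ --> X](mulr0 K) -[in X in _ --> X](normr0 R) -g0.
  apply: cvgMl_tmp; apply: cvg_norm; apply: cvg_within_filter.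
  apply: cvg_within_filter.
  exact: continuous_horner.
(* [exp(-1/t) <= k! t^k] with [k = 2n+2] leaves a factor q^2, which absorbs the
   division by [y - x] since q vanishes at [x]. *)
apply: norm_cvg0.
apply: (@squeeze_cvgr _ _ _ _ (cst 0) (fun y => K * `|g.[y]|)) => //.
  rewrite near_withinE; near=> y => Ay.
  rewrite normr_ge0/=.
  have yx : 0 < `|y - x|.
    rewrite normr_gt0 subr_eq0; near: y; exact: nbhs_dnbhs_neq.
  rewrite subr0 normrM normfV ler_pdivrMr//.
  apply: (le_trans (exp_inv_le n y)).
  rewrite /g !hornerM !normrM -!mulrA ler_wpM2l ?ler0n// ler_wpM2l//.
  by rewrite -normrM -(hornerXsubC x) -hornerM -qE -normrM -expr2 ger0_norm// sqr_ge0.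
exact: cvg_cst.
Unshelve. all: by end_near. Qed.
End exp_inv_poly.

(** * Runs that see only zeros *)

(** A zero prefix padded with 0 is the zero sequence, so by induction the stopping rule is only
    consulted there and each node only at a zero tuple. *)
Lemma info_prefix_eq0 (R : realType) (n : (nat -> R) -> option nat)
    (X : forall i, i.-tuple R -> R) (f : R -> R) :
  (forall i, at_least (n (fun=> 0)) i.+1 -> f (X i [tuple of nseq i 0]) = 0) ->
  forall i, info_prefix n X f i = [tuple of nseq i 0].
Proof.
move=> f0; elim=> [|i IHi]; first exact: val_inj.
apply: val_inj; rewrite /= IHi.
have -> : nth 0 [tuple of nseq i 0] = fun=> 0 :> R.
  by apply/funext => j; rewrite nth_nseq if_same.
set y := (if _ then _ else _); have -> : y = 0 by rewrite /y; case: ifP => // /f0.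
by rewrite -cats1 -[[:: 0]]/(nseq 1 0) -nseqD addn1.
Qed.

Lemma info_eq0 (R : realType) (n : (nat -> R) -> option nat)
    (X : forall i, i.-tuple R -> R) (f : R -> R) :
  (forall i, at_least (n (fun=> 0)) i.+1 -> f (X i [tuple of nseq i 0]) = 0) ->
  info n X f = fun=> 0.
Proof.
move=> f0; apply/funext => i.
by rewrite /info (info_prefix_eq0 f0) -nth_last nth_nseq if_same.
Qed.

Lemma algo_info0 (R : realType) (F : set (R -> R)) (Q : rand_algorithm F) w :
  algo_info (r := Q) w (fun=> 0) = fun=> 0.
Proof. by apply: info_eq0. Qed.

Lemma measurable_output (R : realType) (F : set (R -> R))
    (Q : rand_algorithm F) (f : R -> R) :
  F f -> measurable_fun setT (fun w => output (Q := Q) w f).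
Proof.
move=> Ff; rewrite /output.
apply: (measurableT_comp (f := @phi _ _ Q) (g := fun w => (U Q w, algo_info w f))).
  exact: measurable_phi.
by apply: measurable_fun_pair; last exact: measurable_info.
Qed.

Lemma measurable_accuracy (R : realType) (F : set (R -> R))
    (Q : rand_algorithm F) (f : R -> R) (c e : R) :
  F f -> measurable [set w | `|output (Q := Q) w f - c| <= e].
Proof.
move=> /(@measurable_output _ _ Q) mf.
rewrite -[X in measurable X]setTI.
apply: (@measurable_fun_le _ _ R setT (fun w => `|output (Q := Q) w f - c|) (cst e)).
  exact: measurableT.
- by apply: measurableT_comp => //; apply: measurable_realfun.measurable_funB.
- by [].
Qed.

Lemma output_eq_zero_of_small_support (R : realType) (F : set (R -> R))
    (Q : rand_algorithm F) (e : R) : F (fun=> 0) -> 0 < e ->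
  exists2 a : R, 0 < a <= 1 &
  exists2 G : set (Omega Q), measurable G /\ (prob Q (~` G) <= e%:E)%E &
  forall (f : R -> R) w, G w -> (forall x, x \notin `]0, a[ -> f x = 0) ->
    output w f = output w (fun=> 0).
Proof.
move=> F0 e0.
pose z i : i.-tuple R := [tuple of nseq i 0].
pose S w := @stop _ _ Q (U Q w, fun=> 0).
pose V k := ~` `]0, (k.+1%:R : R)^-1[%classic.
(* On [G k] the run on the zero function takes c <= k samples, none of them in ]0, 1/(k+1)[; [z i]
   is the data preceding sample [i]. *)
pose G k := \bigcup_(c in `I_k.+1) ((S @^-1` [set Some c]) `&`
  \bigcap_(i in `I_c) ((fun w => @node _ _ Q i (w, z i)) @^-1` V k)).
have mS B : measurable (S @^-1` B).
  have mp : measurable_fun setT (fun w => (U Q w, (fun=> 0) : seqR R)).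
    apply: measurable_fun_pair => //.
  rewrite -[X in measurable X]setTI.
  exact: (mp measurableT _ (measurable_stop B)).
have mV k : measurable (V k) by exact: measurableC.
have mG k : measurable (G k).
  apply: bigcup_measurable => c _; apply: measurableI => //.
  apply: bigcap_measurableType => i ic; rewrite -[X in measurable X]setTI.
  have mn : measurable_fun setT (fun w => @node _ _ Q i (w, z i)).
    apply: (measurableT_comp (f := @node _ _ Q i) (g := fun w => (w, z i))).
      exact: measurable_node.
    exact: pair2_measurable.
  exact: (mn measurableT _ (mV k)).
have G_homo : {homo G : n m / (n <= m)%N >-> (n <= m)%O}.
  move=> n m nm; apply/subsetPset => w [c /= cn [Sc Nc]].
  exists c; first exact: leq_trans cn _.
  split=> // i /Nc; rewrite /V/=; apply: contra_not.
  rewrite !in_itv/= => /andP[-> /lt_le_trans]; apply.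
  by rewrite lef_pV2 ?posrE// ler_nat.
have G_cover : \bigcup_k G k = [set w | S w != None].
  apply/seteqP; split=> w; first by move=> [k _ [c _ [/= -> _]]].
  rewrite /=; case Sc : (S w) => [c|//] _.
  (* A node at or below 0 avoids every such interval, a positive one all but finitely many; since c
     is finite, one [k] serves all nodes. *)
  have : \forall k \near \oo,
      (c <= k)%N /\ forall i : 'I_c, V k (node (i := i) (w, z i)).
    near=> k; split; first by near: k; exact: nbhs_infty_ge.
    near: k; apply: filter_forall => i; rewrite /V/=.
    have [x0|x0] := leP (node (i := i) (w, z i)) 0.
      by near=> k; rewrite in_itv/= ltNge x0.
    near=> k; rewrite in_itv/= x0/=; apply/negP; rewrite -leNgt ltW//.
    by near: k; exact: (near_infty_natSinv_lt (PosNum x0)).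
  move=> /filter_ex[k [ck Vk]]; exists k => //; exists c => //; split=> // i ic.
  exact: (Vk (Ordinal ic)).
have PG : prob Q (\bigcup_k G k) = 1%E.
  have mU : measurable (\bigcup_k G k) by exact: bigcupT_measurable.
  suff : prob Q (~` \bigcup_k G k) = 0%E.
    move=> PU; rewrite -(setCK (\bigcup_k G k)) probability_setC ?PU ?sube0//.
    exact: measurableC.
  apply: measure_negligible; first exact: measurableC.
  (* The information on the zero function is the zero sequence, so the finite cost there says
     exactly that [S w] is almost surely not [None]. *)
  have := @cost_finite _ _ Q _ F0; rewrite G_cover.
  by under [X in _ -> _.-negligible (~` X)]eq_set => w do rewrite /S -(algo_info0 w).
have cvgG : prob Q (G k) @[k --> \oo] --> 1%E.
  by rewrite -PG; exact: nondecreasing_cvg_mu mG (bigcupT_measurable _ mG) G_homo.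
have [k PGk] : exists k, ((1 - e)%:E <= prob Q (G k))%E.
  have : \forall k \near \oo, ((1 - e)%:E <= prob Q (G k))%E.
    apply: lte_lim.
    - by move=> n m nm; apply: le_measure; rewrite ?inE//; apply/subsetPset/G_homo.
    - by apply/cvg_ex; exists 1%E.
    - by rewrite (cvg_lim _ cvgG)// lte_fin ltrBlDr ltrDl.
  by move=> /filter_ex.
exists k.+1%:R^-1; first by rewrite invr_gt0 ltr0n/= invf_le1// ler1n.
exists (G k); first split => //.
  rewrite probability_setC// leeBlDr ?fin_num_measure//.
  by rewrite addeC -leeBlDr// -EFinB.
move=> f w [c ck [Sc Nc]] f0.
rewrite /output algo_info0; congr (phi (_, _)); apply: info_eq0 => i.
(* Counting from 0, sample [i] is taken exactly when i < c, the index range of the intersection in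
   [G k]. *)
rewrite -[stop _]/(S w) Sc /= => ic; apply: f0.
exact/negP/Nc.
Unshelve. all: by end_near. Qed.

(** * A smooth bump on a short interval with large integral *)

Lemma Cinfty01_scale_exp_inv (R : realType) (q : {poly R}) (c : R) :
  Cinfty01 (fun x => c * exp_inv q 0 x).
Proof.
exists (fun k x => c * exp_inv q k x) => // k x x01.
have -> : (fun y => (c * exp_inv q k y - c * exp_inv q k x) / (y - x)) =
    (fun y => c * ((exp_inv q k y - exp_inv q k x) / (y - x))).
  by apply/funext => y; rewrite -mulrBr mulrA.
by apply: cvgMl_tmp; exact: exp_inv_quotient_cvg.
Qed.

Lemma INT_ge (R : realType) (f : R -> R) (m x y : R) :
  Cinfty01 f -> 0 <= x <= y -> y <= 1 -> 0 <= m -> (forall t, 0 <= f t) ->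
  (forall t, t \in `[x, y] -> m <= f t) -> m * (y - x) <= INT f.
Proof.
move=> Cf /andP[x0 xy] y1 m0 f0 mf; have intf := Cinfty01_integrable Cf.
have mf01 := measurable_int _ intf.
have xy01 : `[x, y] `<=` `[0, 1]%classic.
  move=> t/=; rewrite !in_itv/= => /andP[xt ty].
  by rewrite (le_trans x0 xt) (le_trans ty y1).
rewrite -lee_fin /INT /Rintegral fineK; last exact: integrable_fin_num.
have le1 : (\int[@lebesgue_measure R]_(t in `[x, y]) (f t)%:E <=
    \int[@lebesgue_measure R]_(t in `[0%R, 1%R]) (f t)%:E)%E.
  by apply: ge0_subset_integral => // t _; rewrite lee_fin.
apply: le_trans le1.
have -> : ((m * (y - x))%:E = \int[@lebesgue_measure R]_(t in `[x, y]) m%:E)%E.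
  rewrite integral_cst//= lebesgue_measure_itv/= lte_fin.
  case: ltP => [_|yx]; first by rewrite -EFinB -EFinM.
  by rewrite (@le_anti _ _ x y) ?xy// subrr mulr0 mule0.
by apply: ge0_le_integral => //; exact: measurable_funS mf01.
Qed.

(** The polynomial x (a - x) is positive exactly on ]0, a[, so exp(-1/q) has the right support and
    smoothness; a constant factor adjusts the integral. *)
Lemma smooth_bump (R : realType) (a : R) : 0 < a <= 1 ->
  exists2 f : R -> R, Cinfty01 f &
    (forall x, x \notin `]0, a[ -> f x = 0) /\ 3 <= INT f.
Proof.
move=> /andP[a0 a1].
pose q : {poly R} := 'X * (a%:P - 'X).
have qE x : q.[x] = x * (a - x) by rewrite /q !hornerE.
(* On [a/4, 3a/4] the minimum of q is 3a^2/16, taken at the endpoints, so exp(s) exp(-1/q) >= 1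
   there. The factor 6/a times the length a/2 gives 3. *)
pose s := (3 / 16 * a ^+ 2)^-1.
pose f x := 6 / a * expR s * exp_inv q 0 x.
have Cf : Cinfty01 f by exact: Cinfty01_scale_exp_inv.
have c0 : 0 <= 6 / a * expR s by rewrite mulr_ge0 ?expR_ge0// divr_ge0 ?ltW.
have b0E x : exp_inv q 0 x = if 0 < q.[x] then expR (- q.[x]^-1) else 0.
  by rewrite /exp_inv /= expr0 divr1 hornerC mul1r.
exists f => //; split=> [x xa|].
  rewrite /f b0E ifN ?mulr0// qE; apply: contra xa => xa.
  rewrite in_itv/=; apply/andP; split; nra.
have -> : 3 = 6 / a * (3 / 4 * a - a / 4) :> R by field; exact: lt0r_neq0.
apply: INT_ge => //.
- by apply/andP; split; lra.
- lra.
- by rewrite divr_ge0 ?ltW.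
- move=> t; rewrite /f mulr_ge0// b0E; case: ifP => // _; exact: expR_ge0.
move=> t; rewrite in_itv/= => /andP[ta at'].
have s0 : 0 < 3 / 16 * a ^+ 2 by rewrite mulr_gt0 ?exprn_gt0// divr_gt0.
have qs : 3 / 16 * a ^+ 2 <= q.[t] by rewrite qE; nra.
have q0 := lt_le_trans s0 qs.
rewrite /f b0E q0 -mulrA ler_peMr//; first by rewrite divr_ge0// ltW.
rewrite -expRD -[leLHS]expR0 ler_expR subr_ge0.
by rewrite lef_pV2.
Qed.

(** * Union bound over three exceptional events *)

Theorem theorem3p15 (R : realType) : ~ integration_solvable (@Cinfty01 R).
Proof.
(* Three exceptional events of probability at most 1/4 each leave a set of positive probability. *)
move=> /(_ 1 4^-1 ltr01); case; first by apply/andP; split; lra.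
move=> Q PQ.
have F0 : @Cinfty01 R (fun=> 0).
  exists (fun _ _ => 0) => // k x _.
  by under eq_fun do rewrite subrr mul0r; exact: cvg_cst.
have e0 : 0 < 4^-1 :> R by rewrite invr_gt0.
have [a a01 [G [mG PG] Geq]] := output_eq_zero_of_small_support Q F0 e0.
have [f Cf [f0 INTf]] := smooth_bump a01.
have INT0 : INT (fun=> 0 : R) = 0 :> R by rewrite /INT Rintegral_cst ?mul0r.
pose A g := [set w | `|output (Q := Q) w g - INT g| <= 1].
have mA g : Cinfty01 g -> measurable (A g).
  by move=> Cg; exact: measurable_accuracy.
have PA g : Cinfty01 g -> (prob Q (~` A g) <= (4^-1)%:E)%E.
  move=> Cg; rewrite probability_setC; last exact: mA.
  rewrite leeBlDr ?fin_num_measure//; last exact: mA.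
  by rewrite addeC -leeBlDr// -EFinB; exact: PQ.
(* On [G] the outputs for [f] and 0 coincide, so accuracy on both would force [INT f] <= 2. *)
have cover : setT `<=` ~` G `|` ~` A (fun=> 0) `|` ~` A f.
  move=> w _; rewrite -!setCI => -[[Gw]].
  rewrite /A/= INT0 subr0 (Geq f w Gw f0) => A0 Af.
  have : 3 <= `|INT f| by rewrite ger0_norm//; lra.
  rewrite -[INT f](subKr (output w (fun=> 0))) => H.
  have := le_trans H (ler_normB _ _); lra.
have mG' : measurable (~` G) by exact: measurableC.
have mA0' : measurable (~` A (fun=> 0)) by apply: measurableC; exact: mA.
have mAf' : measurable (~` A f) by apply: measurableC; exact: mA.
have : (1 <= prob Q (~` G `|` ~` A (fun=> 0%R) `|` ~` A f))%E.
  rewrite -(probability_setT (prob Q)); apply: le_measure => //; rewrite inE.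
    exact: measurableT.
  by do 2 apply: measurableU => //.
rewrite leNgt => /negP; apply.
apply: le_lt_trans (measureU2 _ (measurableU _ _ mG' mA0') mAf') _.
apply: le_lt_trans (leeD (measureU2 _ mG' mA0') (PA _ Cf)) _.
apply: le_lt_trans (leeD (leeD PG (PA _ F0)) (lexx _)) _.
by rewrite -!EFinD lte_fin; lra.
Qed.
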